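(* Let $K$ be a field and let $k,l\geq 1$ be integers. If $\operatorname{char}K\neq 2,3$, then the algebra $E\otimes E_{2k}\otimes\underbrace{E_2\otimes\cdots\otimes E_2}_{l}$ satisfies the identity $[x_1,\dots,x_{2k+2l+3}]=0$. Moreover, if $\operatorname{char}K\neq 2$, then $E\otimes E_{2k}\otimes\underbrace{E_2\otimes\cdots\otimes E_2}_{l}$ does not satisfy the identity $[x_1,\dots,x_{2k+2l+2}]=0$.
   Context: $E$ denotes the (unital) Grassmann (exterior) algebra over a $K$-vector space of countably infinite dimension, and $E_r$ ($r\ge2$) the Grassmann algebra over an $r$-dimensional $K$-vector space. $\otimes=\otimes_K$ is the ordinary (ungraded) tensor product of algebras. Long commutators are left-normed: $[u_1,u_2]=u_1u_2-u_2u_1$ and $[u_1,\dots,u_{m+1}]=[[u_1,\dots,u_m],u_{m+1}]$ for $m\ge 2$. An algebra satisfies an identity if the identity holds for all substitutions of algebra elements for the variables. *)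

(* Defs.v *)
From HB Require Import structures.
From mathcomp Require Import all_boot all_order all_algebra.
From mathcomp Require Import boolp classical_sets.

Set Implicit Arguments.
Unset Strict Implicit.
Unset Printing Implicit Defensive.

Import GRing.Theory.
Local Open Scope ring_scope.
Local Open Scope quotient_scope.

(* Tensor product of two K-algebras. A formal sum a_1 (x) b_1 + ... +
   a_n (x) b_n is the list of the pairs (a_i, b_i); two formal sums are
   identified when every bilinear map gives them the same value, so that the
   quotient is the vector space with the universal property of the tensor
   product (tensor_bilinear, tensor_liftP and tensor_lift_uniq below). *)
Section Tensor.

Variables (K : fieldType) (A B : algType K).

Definition tens_eval (W : lmodType K) (h : A -> B -> W) (s : seq (A * B)) : W :=
  \sum_(p <- s) h p.1 p.2.

Definition tens_rel (s t : seq (A * B)) : bool :=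
  `[< forall (W : lmodType K) (h : A -> B -> W),
        bilinear_for *:%R *:%R h -> tens_eval h s = tens_eval h t >].

Fact tens_rel_refl : reflexive tens_rel.
Proof. by move=> s; apply/asboolP. Qed.

Fact tens_rel_sym : symmetric tens_rel.
Proof. by move=> s t; apply/asboolP/asboolP => H W h hh; rewrite H. Qed.

Fact tens_rel_trans : transitive tens_rel.
Proof.
move=> t s u /asboolP H1 /asboolP H2; apply/asboolP => W h hh.
by rewrite H1 // H2.
Qed.

Canonical tens_equiv := EquivRel tens_rel tens_rel_refl tens_rel_sym
  tens_rel_trans.

Definition tensor := {eq_quot tens_rel}.
HB.instance Definition _ := Choice.on tensor.
HB.instance Definition _ := EqQuotient.on tensor.

Definition tensor_lift (W : lmodType K) (h : A -> B -> W) (x : tensor) : W :=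
  tens_eval h (repr x).

Definition tens (a : A) (b : B) : tensor := \pi_tensor [:: (a, b)].

Definition tens_mul (s t : seq (A * B)) : seq (A * B) :=
  [seq (p.1 * q.1, p.2 * q.2) | p <- s, q <- t].

Definition tensor_zero : tensor := \pi_tensor [::].
Definition tensor_add (x y : tensor) : tensor :=
  \pi_tensor (repr x ++ repr y).
Definition tensor_scale (c : K) (x : tensor) : tensor :=
  \pi_tensor [seq (c *: p.1, p.2) | p <- repr x].
Definition tensor_one : tensor := tens 1 1.
Definition tensor_mul (x y : tensor) : tensor :=
  \pi_tensor (tens_mul (repr x) (repr y)).

Lemma tens_piP (s t : seq (A * B)) :
  \pi_tensor s = \pi_tensor t <->
  forall (W : lmodType K) (h : A -> B -> W),
    bilinear_for *:%R *:%R h -> tens_eval h s = tens_eval h t.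
Proof. by split=> [/eqmodP/asboolP | H]; last by apply/eqmodP/asboolP. Qed.

Section Lift.
Variables (W : lmodType K) (h : A -> B -> W).
Hypothesis hh : bilinear_for *:%R *:%R h.

Lemma tensor_lift_pi s : tensor_lift h (\pi_tensor s) = tens_eval h s.
Proof. by move: hh; apply: (tens_piP _ _).1; rewrite reprK. Qed.

Lemma tensor_lift_tens a b : tensor_lift h (tens a b) = h a b.
Proof. by rewrite tensor_lift_pi /tens_eval big_seq1. Qed.

Lemma tensor_lift0 : tensor_lift h tensor_zero = 0.
Proof. by rewrite tensor_lift_pi /tens_eval big_nil. Qed.

Lemma tensor_liftD x y :
  tensor_lift h (tensor_add x y) = tensor_lift h x + tensor_lift h y.
Proof. by rewrite tensor_lift_pi /tens_eval big_cat. Qed.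

Lemma tensor_liftZ c x :
  tensor_lift h (tensor_scale c x) = c *: tensor_lift h x.
Proof.
rewrite tensor_lift_pi /tensor_lift /tens_eval big_map scaler_sumr.
apply: eq_bigr => p _ /=.
have := hh.1 p.2 c p.1 0; have := hh.1 p.2 (-1) 0 0.
by rewrite /= !scaler0 !addr0 scaleN1r addNr => ->; rewrite !addr0.
Qed.

Lemma tensor_liftM x y :
  tensor_lift h (tensor_mul x y) =
  tens_eval (fun a b => tens_eval (fun a' b' => h (a * a') (b * b')) (repr y))
    (repr x).
Proof. by rewrite tensor_lift_pi /tens_eval big_allpairs_dep. Qed.

Lemma bilin_mull a b : bilinear_for *:%R *:%R (fun a' b' => h (a * a') (b * b')).
Proof.
by split=> u c x y /=; rewrite mulrDr -scalerAr; [rewrite hh.1|rewrite hh.2].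
Qed.

Lemma bilin_mulr a b : bilinear_for *:%R *:%R (fun a' b' => h (a' * a) (b' * b)).
Proof.
by split=> u c x y /=; rewrite mulrDl -scalerAl; [rewrite hh.1|rewrite hh.2].
Qed.

Lemma tensor_lift_mulpi s t :
  tensor_lift h (tensor_mul (\pi_tensor s) (\pi_tensor t)) =
  tens_eval (fun a b => tens_eval (fun a' b' => h (a * a') (b * b')) t) s.
Proof.
rewrite tensor_liftM /tens_eval.
transitivity (\sum_(p <- repr (\pi_tensor s)) \sum_(q <- t)
                h (p.1 * q.1) (p.2 * q.2)).
  by apply: eq_bigr => p _; apply: (tens_piP _ _).1 (bilin_mull _ _);
     rewrite reprK.
rewrite exchange_big [RHS]exchange_big; apply: eq_bigr => q _ /=.
by apply: (tens_piP _ _).1 (bilin_mulr q.1 q.2); rewrite reprK.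
Qed.

End Lift.

Lemma tensor_ext (x y : tensor) :
  (forall (W : lmodType K) (h : A -> B -> W), bilinear_for *:%R *:%R h ->
     tensor_lift h x = tensor_lift h y) -> x = y.
Proof. by move=> H; rewrite -[x]reprK -[y]reprK; apply/tens_piP. Qed.

Lemma tensor_mul_pi s t :
  tensor_mul (\pi_tensor s) (\pi_tensor t) = \pi_tensor (tens_mul s t).
Proof.
apply: tensor_ext => W h hh; rewrite tensor_lift_mulpi // tensor_lift_pi //.
by rewrite /tens_eval big_allpairs_dep.
Qed.

Definition tensor_opp := tensor_scale (-1).

Fact tensor_addA : associative tensor_add.
Proof. by move=> x y z; apply: tensor_ext => W h hh; rewrite !tensor_liftD ?addrA. Qed.
Fact tensor_addC : commutative tensor_add.
Proof. by move=> x y; apply: tensor_ext => W h hh; rewrite !tensor_liftD // addrC. Qed.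
Fact tensor_add0 : left_id tensor_zero tensor_add.
Proof.
by move=> x; apply: tensor_ext => W h hh; rewrite tensor_liftD // tensor_lift0 // add0r.
Qed.
Fact tensor_addN : left_inverse tensor_zero tensor_opp tensor_add.
Proof.
move=> x; apply: tensor_ext => W h hh.
by rewrite tensor_liftD // tensor_lift0 // tensor_liftZ // scaleN1r addNr.
Qed.

HB.instance Definition _ := GRing.isZmodule.Build tensor
  tensor_addA tensor_addC tensor_add0 tensor_addN.

Fact tensor_scaleA a b x :
  tensor_scale a (tensor_scale b x) = tensor_scale (a * b) x.
Proof. by apply: tensor_ext => W h hh; rewrite !tensor_liftZ // scalerA. Qed.
Fact tensor_scale1 : left_id 1 tensor_scale.
Proof. by move=> x; apply: tensor_ext => W h hh; rewrite !tensor_liftZ // scale1r. Qed.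
Fact tensor_scaleDr : right_distributive tensor_scale +%R.
Proof.
move=> a x y; apply: tensor_ext => W h hh.
by rewrite tensor_liftZ // !tensor_liftD // !tensor_liftZ // scalerDr.
Qed.
Fact tensor_scaleDl x : {morph tensor_scale^~ x : a b / a + b}.
Proof.
move=> a b; apply: tensor_ext => W h hh.
by rewrite tensor_liftZ // tensor_liftD // !tensor_liftZ // scalerDl.
Qed.

HB.instance Definition _ := GRing.Zmodule_isLmodule.Build K tensor
  tensor_scaleA tensor_scale1 tensor_scaleDr tensor_scaleDl.

Lemma tensor_liftP (W : lmodType K) (h : A -> B -> W) :
  bilinear_for *:%R *:%R h ->
  linear (tensor_lift h) /\ forall a b, tensor_lift h (tens a b) = h a b.
Proof.
move=> hh; split=> [c x y|a b]; last exact: tensor_lift_tens.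
by rewrite tensor_liftD // tensor_liftZ.
Qed.

Lemma tensor_bilinear : bilinear_for *:%R *:%R tens.
Proof.
split=> u c x y; apply: tensor_ext => W h hh;
  rewrite tensor_liftD // tensor_liftZ // !tensor_lift_tens //.
  exact: hh.1.
exact: hh.2.
Qed.

Lemma tensZl c a b : tens (c *: a) b = c *: tens a b.
Proof. exact: (scalable_linear (tensor_bilinear.1 b)). Qed.

Lemma tensZr c a b : tens a (c *: b) = c *: tens a b.
Proof. exact: (scalable_linear (tensor_bilinear.2 a)). Qed.

Lemma pi_tensorE s : \pi_tensor s = \sum_(p <- s) tens p.1 p.2.
Proof.
elim: s => [|p s IH]; first by rewrite big_nil.
rewrite big_cons -IH; apply: tensor_ext => W h hh.
by rewrite tensor_liftD // !tensor_lift_pi // /tens_eval big_cons big_seq1.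
Qed.

Lemma tensorE (x : tensor) : x = \sum_(p <- repr x) tens p.1 p.2.
Proof. by rewrite -pi_tensorE reprK. Qed.

Lemma tensor_lift_uniq (W : lmodType K) (g g' : {linear tensor -> W}) :
  (forall a b, g (tens a b) = g' (tens a b)) -> g =1 g'.
Proof.
by move=> H x; rewrite [x]tensorE !linear_sum; apply: eq_bigr => p _.
Qed.

Fact tensor_mulA : associative tensor_mul.
Proof.
elim/quotW=> x; elim/quotW=> y; elim/quotW=> z.
rewrite (tensor_mul_pi y z) (tensor_mul_pi x y) (tensor_mul_pi x).
rewrite (tensor_mul_pi _ z).
apply/tens_piP => W h hh; rewrite /tens_eval !big_allpairs_dep /=.
apply: eq_bigr => p _; rewrite big_allpairs_dep; apply: eq_bigr => q _.
by apply: eq_bigr => r _ /=; rewrite !mulrA.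
Qed.
Fact tensor_mul1 : left_id tensor_one tensor_mul.
Proof.
elim/quotW=> x; rewrite tensor_mul_pi; apply/tens_piP => W h hh.
rewrite /tens_eval big_allpairs_dep big_seq1 /=.
by apply: eq_bigr => p _; rewrite !mul1r.
Qed.
Fact tensor_mulr1 : right_id tensor_one tensor_mul.
Proof.
elim/quotW=> x; rewrite tensor_mul_pi; apply/tens_piP => W h hh.
rewrite /tens_eval big_allpairs_dep /=.
by apply: eq_bigr => p _; rewrite big_seq1 /= !mulr1.
Qed.
Fact tensor_mulDl : left_distributive tensor_mul +%R.
Proof.
move=> x y z; apply: tensor_ext => W h hh; rewrite tensor_liftD //.
rewrite [in LHS]/GRing.add /= /tensor_add -[in LHS](reprK z).
rewrite tensor_lift_mulpi // !tensor_liftM //.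
by rewrite /tens_eval big_cat.
Qed.
Fact tensor_mulDr : right_distributive tensor_mul +%R.
Proof.
move=> x y z; apply: tensor_ext => W h hh; rewrite tensor_liftD //.
rewrite [in LHS]/GRing.add /= /tensor_add -[in LHS](reprK x).
rewrite tensor_lift_mulpi // !tensor_liftM // /tens_eval -big_split.
by apply: eq_bigr => p _; rewrite big_cat.
Qed.

(* A linear functional equal to 1 on the unit, used for 1 (x) 1 != 0. *)
Lemma exists_unit_functional (C : algType K) :
  exists f : C -> K, (forall c x y, f (c *: x + y) = c * f x + f y) /\ f 1 = 1.
Proof.
pose P (M : set C) :=
  (forall c x y, M x -> M y -> M (c *: x + y)) /\ ~ M 1.
have [F FP Ftot|M [[Mlin M1] Mmax]] := @Zorn_bigcup C P.
  split=> [c x y [X FX Xx] [Y FY Yy]|[X FX X1]]; last by have [] := FP X FX.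
  have [XY|YX] := Ftot X Y FX FY.
    by exists Y => //; apply: (FP Y FY).1 => //; apply: XY.
  by exists X => //; apply: (FP X FX).1 => //; apply: YX.
have M0 : M 0.
  case: (pselect (M 0)) => // nM0; case: (Mmax [set 0]%classic).
    split=> [x Mx|sub]; last exact/nM0/sub.
    by case: nM0; have := Mlin (-1) x x Mx Mx; rewrite scaleN1r addNr.
  split=> [c x y /= -> ->|/= /eqP]; first by rewrite scaler0 addr0.
  by rewrite oner_eq0.
have MZ c x : M x -> M (c *: x) by move=> Mx; rewrite -[_ *: _]addr0; apply: Mlin.
have fP x : exists c : K, M (x - c *: 1).
  case: (pselect (M x)) => [Mx|nMx]; first by exists 0; rewrite scale0r subr0.
  pose N : set C := fun y => exists c m, M m /\ y = c *: x + m.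
  have Nlin c u v : N u -> N v -> N (c *: u + v).
    move=> [a [m [Mm ->]]] [b [n [Mn ->]]]; exists (c * a + b), (c *: m + n).
    split; first exact: Mlin.
    by rewrite scalerDr scalerA scalerDl addrACA.
  case: (pselect (N 1)) => [[c [m [Mm E1]]]|nN1]; last first.
    case: (Mmax N) => //; split=> [y My|sub].
      by exists 0, y; rewrite scale0r add0r.
    by apply/nMx/sub; exists 1, 0; rewrite scale1r addr0.
  have c0 : c != 0.
    by apply/eqP => c0; apply: M1; rewrite E1 c0 scale0r add0r.
  exists c^-1; rewrite E1 scalerDr scalerA mulVf // scale1r opprD addNKr.
  by rewrite -scaleN1r; apply/MZ/MZ.
have funi x a b : M (x - a *: 1) -> M (x - b *: 1) -> a = b.
  move=> Ma Mb; apply/eqP/negP => /negP ab; apply: M1.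
  have := MZ (b - a)^-1 _ (Mlin (-1) _ _ Mb Ma).
  rewrite scaleN1r opprB addrA subrK -scalerBl scalerA mulVf ?scale1r //.
  by rewrite subr_eq0 eq_sym.
pose f x := projT1 (cid (fP x)).
have Mf x : M (x - f x *: 1) by rewrite /f; case: cid.
exists f; split=> [c x y|]; apply: funi (Mf _) _.
  have := Mlin c _ _ (Mf x) (Mf y).
  by rewrite scalerBr scalerA addrACA -opprD -scalerDl.
by rewrite scale1r subrr.
Qed.

Fact tensor_one_neq0 : tensor_one != 0.
Proof.
have [f [flin f1]] := exists_unit_functional A.
have [g [glin g1]] := exists_unit_functional B.
pose h (a : A) (b : B) : K^o := f a * g b.
have hh : bilinear_for *:%R *:%R h.
  split=> u c x y; rewrite /h /=; first by rewrite flin mulrDl -mulrA.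
  by rewrite glin mulrDr mulrCA.
apply/eqP => /(congr1 (tensor_lift h)).
rewrite tensor_lift_tens // tensor_lift0 // /h f1 g1 mulr1 => /eqP.
by rewrite oner_eq0.
Qed.

HB.instance Definition _ := GRing.Zmodule_isNzRing.Build tensor
  tensor_mulA tensor_mul1 tensor_mulr1 tensor_mulDl tensor_mulDr
  tensor_one_neq0.

Lemma tensM (a a' : A) (b b' : B) :
  tens a b * tens a' b' = tens (a * a') (b * b').
Proof. exact: (tensor_mul_pi [:: (a, b)] [:: (a', b')]). Qed.

Fact tensor_scaleAl (c : K) (x y : tensor) : c *: (x * y) = (c *: x) * y.
Proof.
rewrite [x]tensorE [y]tensorE scaler_sumr !mulr_suml scaler_sumr.
apply: eq_bigr => p _; rewrite !mulr_sumr scaler_sumr.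
by apply: eq_bigr => q _; rewrite tensM -!tensZl tensM scalerAl.
Qed.

Fact tensor_scaleAr (c : K) (x y : tensor) : c *: (x * y) = x * (c *: y).
Proof.
rewrite [x]tensorE [y]tensorE scaler_sumr !mulr_suml scaler_sumr.
apply: eq_bigr => p _; rewrite !mulr_sumr scaler_sumr.
by apply: eq_bigr => q _; rewrite tensM -!tensZr tensM scalerAr.
Qed.

HB.instance Definition _ :=
  GRing.Lmodule_isLalgebra.Build K tensor tensor_scaleAl.
HB.instance Definition _ :=
  GRing.Lalgebra_isAlgebra.Build K tensor tensor_scaleAr.

End Tensor.

(* The Grassmann (exterior) algebra of a vector space V. A formal linear
   combination c_1 v_11...v_1m + ... + c_n v_n1...v_np of words over V is the
   list of the pairs (c_i, [:: v_i1; ...]); two of them are identified when they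
   have the same value under every linear map f from V to a unital algebra such
   that f v * f v = 0, so that the quotient is the algebra with the universal
   property of the exterior algebra (gr_gen_sqr, grassmann_liftP and
   grassmann_lift_uniq below). *)
Section Grassmann.

Variables (K : fieldType) (V : lmodType K).

Definition sqr0 (B : algType K) (f : V -> B) := forall v, f v * f v = 0.

Definition gr_eval (B : algType K) (f : V -> B) (s : seq (K * seq V)) : B :=
  \sum_(p <- s) p.1 *: \prod_(v <- p.2) f v.

Definition gr_rel (s t : seq (K * seq V)) : bool :=
  `[< forall (B : algType K) (f : {linear V -> B}),
        sqr0 f -> gr_eval f s = gr_eval f t >].

Fact gr_rel_refl : reflexive gr_rel.
Proof. by move=> s; apply/asboolP. Qed.

Fact gr_rel_sym : symmetric gr_rel.
Proof. by move=> s t; apply/asboolP/asboolP => H B f hf; rewrite H. Qed.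

Fact gr_rel_trans : transitive gr_rel.
Proof.
move=> t s u /asboolP H1 /asboolP H2; apply/asboolP => B f hf.
by rewrite H1 // H2.
Qed.

Canonical gr_equiv := EquivRel gr_rel gr_rel_refl gr_rel_sym gr_rel_trans.

Definition grassmann := {eq_quot gr_rel}.
HB.instance Definition _ := Choice.on grassmann.
HB.instance Definition _ := EqQuotient.on grassmann.

Definition grassmann_lift (B : algType K) (f : V -> B) (x : grassmann) : B :=
  gr_eval f (repr x).

Definition gr_gen (v : V) : grassmann := \pi_grassmann [:: (1, [:: v])].

Definition gr_zero : grassmann := \pi_grassmann [::].
Definition gr_add (x y : grassmann) : grassmann :=
  \pi_grassmann (repr x ++ repr y).
Definition gr_scale (c : K) (x : grassmann) : grassmann :=
  \pi_grassmann [seq (c * p.1, p.2) | p <- repr x].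
Definition gr_opp : grassmann -> grassmann := gr_scale (-1).
Definition gr_one : grassmann := \pi_grassmann [:: (1, [::])].
Definition gr_mul (x y : grassmann) : grassmann :=
  \pi_grassmann [seq (p.1 * q.1, p.2 ++ q.2) | p <- repr x, q <- repr y].

Lemma gr_piP (s t : seq (K * seq V)) :
  \pi_grassmann s = \pi_grassmann t <->
  forall (B : algType K) (f : {linear V -> B}),
    sqr0 f -> gr_eval f s = gr_eval f t.
Proof. by split=> [/eqmodP/asboolP | H]; last by apply/eqmodP/asboolP. Qed.

Lemma gr_ext (x y : grassmann) :
  (forall (B : algType K) (f : {linear V -> B}), sqr0 f ->
     grassmann_lift f x = grassmann_lift f y) -> x = y.
Proof. by move=> H; rewrite -[x]reprK -[y]reprK; apply/gr_piP. Qed.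

Section Lift.
Variables (B : algType K) (f : {linear V -> B}).
Hypothesis hf : sqr0 f.

Lemma grassmann_lift_pi s : grassmann_lift f (\pi_grassmann s) = gr_eval f s.
Proof. by move: hf; apply: (gr_piP _ _).1; rewrite reprK. Qed.

Lemma grassmann_lift_gen v : grassmann_lift f (gr_gen v) = f v.
Proof. by rewrite grassmann_lift_pi /gr_eval !big_seq1 scale1r. Qed.

Lemma grassmann_lift0 : grassmann_lift f gr_zero = 0.
Proof. by rewrite grassmann_lift_pi /gr_eval big_nil. Qed.

Lemma grassmann_lift1 : grassmann_lift f gr_one = 1.
Proof. by rewrite grassmann_lift_pi /gr_eval big_seq1 big_nil scale1r. Qed.

Lemma grassmann_liftD x y :
  grassmann_lift f (gr_add x y) = grassmann_lift f x + grassmann_lift f y.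
Proof. by rewrite grassmann_lift_pi /gr_eval big_cat. Qed.

Lemma grassmann_liftZ c x :
  grassmann_lift f (gr_scale c x) = c *: grassmann_lift f x.
Proof.
rewrite grassmann_lift_pi /grassmann_lift /gr_eval big_map scaler_sumr.
by apply: eq_bigr => p _; rewrite scalerA.
Qed.

Lemma grassmann_liftM x y :
  grassmann_lift f (gr_mul x y) = grassmann_lift f x * grassmann_lift f y.
Proof.
rewrite grassmann_lift_pi /grassmann_lift /gr_eval big_allpairs_dep mulr_suml.
apply: eq_bigr => p _; rewrite mulr_sumr; apply: eq_bigr => q _ /=.
by rewrite big_cat -scalerAl -scalerAr scalerA.
Qed.

End Lift.

Fact gr_addA : associative gr_add.
Proof. by move=> x y z; apply: gr_ext => B f hf; rewrite !grassmann_liftD ?addrA. Qed.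
Fact gr_addC : commutative gr_add.
Proof. by move=> x y; apply: gr_ext => B f hf; rewrite !grassmann_liftD // addrC. Qed.
Fact gr_add0 : left_id gr_zero gr_add.
Proof.
by move=> x; apply: gr_ext => B f hf; rewrite grassmann_liftD // grassmann_lift0 // add0r.
Qed.
Fact gr_addN : left_inverse gr_zero gr_opp gr_add.
Proof.
move=> x; apply: gr_ext => B f hf.
by rewrite grassmann_liftD // grassmann_lift0 // grassmann_liftZ // scaleN1r addNr.
Qed.

HB.instance Definition _ := GRing.isZmodule.Build grassmann
  gr_addA gr_addC gr_add0 gr_addN.

Fact gr_scaleA a b x : gr_scale a (gr_scale b x) = gr_scale (a * b) x.
Proof. by apply: gr_ext => B f hf; rewrite !grassmann_liftZ // scalerA. Qed.
Fact gr_scale1 : left_id 1 gr_scale.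
Proof. by move=> x; apply: gr_ext => B f hf; rewrite !grassmann_liftZ // scale1r. Qed.
Fact gr_scaleDr : right_distributive gr_scale +%R.
Proof.
move=> a x y; apply: gr_ext => B f hf.
by rewrite grassmann_liftZ // !grassmann_liftD // !grassmann_liftZ // scalerDr.
Qed.
Fact gr_scaleDl x : {morph gr_scale^~ x : a b / a + b}.
Proof.
move=> a b; apply: gr_ext => B f hf.
by rewrite grassmann_liftZ // grassmann_liftD // !grassmann_liftZ // scalerDl.
Qed.

HB.instance Definition _ := GRing.Zmodule_isLmodule.Build K grassmann
  gr_scaleA gr_scale1 gr_scaleDr gr_scaleDl.

Fact gr_mulA : associative gr_mul.
Proof. by move=> x y z; apply: gr_ext => B f hf; rewrite !grassmann_liftM // mulrA. Qed.
Fact gr_mul1 : left_id gr_one gr_mul.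
Proof.
by move=> x; apply: gr_ext => B f hf; rewrite grassmann_liftM // grassmann_lift1 // mul1r.
Qed.
Fact gr_mulr1 : right_id gr_one gr_mul.
Proof.
by move=> x; apply: gr_ext => B f hf; rewrite grassmann_liftM // grassmann_lift1 // mulr1.
Qed.
Fact gr_mulDl : left_distributive gr_mul +%R.
Proof.
move=> x y z; apply: gr_ext => B f hf.
by rewrite grassmann_liftM // !grassmann_liftD // !grassmann_liftM // mulrDl.
Qed.
Fact gr_mulDr : right_distributive gr_mul +%R.
Proof.
move=> x y z; apply: gr_ext => B f hf.
by rewrite grassmann_liftM // !grassmann_liftD // !grassmann_liftM // mulrDr.
Qed.
Fact gr_one_neq0 : gr_one != 0.
Proof.
have hf : sqr0 (\0 : {linear V -> K^o}) by move=> v; rewrite mulr0.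
apply/eqP => /(congr1 (grassmann_lift (\0 : {linear V -> K^o}))).
by rewrite grassmann_lift1 // grassmann_lift0 // => /eqP; rewrite oner_eq0.
Qed.

HB.instance Definition _ := GRing.Zmodule_isNzRing.Build grassmann
  gr_mulA gr_mul1 gr_mulr1 gr_mulDl gr_mulDr gr_one_neq0.

Fact gr_scaleAl (c : K) (x y : grassmann) : c *: (x * y) = (c *: x) * y.
Proof.
apply: gr_ext => B f hf.
by rewrite grassmann_liftZ // !grassmann_liftM // grassmann_liftZ // scalerAl.
Qed.
Fact gr_scaleAr (c : K) (x y : grassmann) : c *: (x * y) = x * (c *: y).
Proof.
apply: gr_ext => B f hf.
by rewrite grassmann_liftZ // !grassmann_liftM // grassmann_liftZ // scalerAr.
Qed.

HB.instance Definition _ :=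
  GRing.Lmodule_isLalgebra.Build K grassmann gr_scaleAl.
HB.instance Definition _ :=
  GRing.Lalgebra_isAlgebra.Build K grassmann gr_scaleAr.

Lemma gr_gen_linear : linear gr_gen.
Proof.
move=> c u v; apply: gr_ext => B f hf.
by rewrite grassmann_liftD // grassmann_liftZ // !grassmann_lift_gen // linearP.
Qed.

Lemma gr_gen_sqr : sqr0 gr_gen.
Proof.
move=> v; apply: gr_ext => B f hf.
by rewrite grassmann_liftM // grassmann_lift0 // grassmann_lift_gen.
Qed.

Lemma grassmann_liftP (B : algType K) (f : {linear V -> B}) : sqr0 f ->
  [/\ linear (grassmann_lift f), monoid_morphism (grassmann_lift f) &
      forall v, grassmann_lift f (gr_gen v) = f v].
Proof.
move=> hf; split=> [c x y||v]; last exact: grassmann_lift_gen.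
  by rewrite grassmann_liftD // grassmann_liftZ.
by split=> [|x y]; [apply: grassmann_lift1 | apply: grassmann_liftM].
Qed.

Lemma grassmannE (x : grassmann) :
  x = \sum_(p <- repr x) p.1 *: \prod_(v <- p.2) gr_gen v.
Proof.
pose g := GRing.isLinear.Build K V grassmann _ gr_gen gr_gen_linear.
pose G : {linear V -> grassmann} := HB.pack gr_gen g.
suff E s : gr_eval G s = \pi_grassmann s by rewrite -[LHS]reprK -E.
elim: s => [|[c w] s IH]; first by rewrite /gr_eval big_nil.
rewrite /gr_eval big_cons -/(gr_eval G s) IH /=.
apply: gr_ext => B f hf; rewrite grassmann_liftD // grassmann_liftZ //.
rewrite !grassmann_lift_pi // /gr_eval big_cons; congr (_ *: _ + _).
elim: w {IH} => [|v w IH]; first by rewrite !big_nil grassmann_lift1.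
by rewrite !big_cons grassmann_liftM // IH grassmann_lift_gen.
Qed.

Lemma grassmann_lift_uniq (B : algType K) (g g' : {lrmorphism grassmann -> B}) :
  (forall v, g (gr_gen v) = g' (gr_gen v)) -> g =1 g'.
Proof.
move=> H x; rewrite [x]grassmannE !linear_sum; apply: eq_bigr => p _.
by rewrite !linearZ_LR !rmorph_prod (eq_bigr _ (fun v _ => H v)).
Qed.

End Grassmann.

(* {poly K} is a K-vector space of countably infinite dimension, with basis
   the powers of 'X. *)
Definition E_inf (K : fieldType) : algType K := grassmann {poly K}.

Definition E_fin (K : fieldType) (r : nat) : algType K := grassmann 'rV[K]_r.

(* ((A (x) B) (x) B) (x) ... (x) B, with l factors B. *)
Fixpoint tensor_iter (K : fieldType) (A B : algType K) (l : nat) : algType K :=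
  if l is l'.+1 then tensor (tensor_iter A B l') B else A.

Definition commutator (R : pzRingType) (u v : R) : R := u * v - v * u.

(* Left-normed: long_commutator [:: u1; ...; um] = [u1, ..., um], with
   [u1] = u1; the value 0 on the empty list is a dummy. *)
Definition long_commutator (R : pzRingType) (s : seq R) : R :=
  if s is u :: s' then foldl (@commutator R) u s' else 0.

Definition lie_nilpotent_identity (R : pzRingType) (m : nat) : Prop :=
  forall x : m.-tuple R, long_commutator x = 0.

(* Main.v *)
(* In E (x) E_r two products of generators commute or anticommute, according to
   the parities of their two degrees, so a commutator of such products is 0 or
   twice their product. A nonzero long commutator uses so many entries of odd
   degree in the second factor that for r = 2k its length is at most 2k + 2.
   Each further factor E_2 adds 2 to the bound. If the commutators of length m
   vanish in R, a commutator of length m + 2 in R (x) E_2 lies in the span of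
   tensors whose left factor is a commutator of length m + 2 or a product of
   commutators of lengths i and j with i + j = m + 2; such a product vanishes by
   the inclusion T^(i) T^(j) <= T^(i + j - 2) of Latyshev and Gupta-Levin.
   For the lower bound, start from a product of an odd number of generators of E
   and bracket with products of a new generator of E and a new generator of E_2k
   or E_2, and finally with one more generator of E: every step doubles the
   product. *)

From HB Require Import structures.
Require Import Defs.
From mathcomp Require Import all_boot all_order all_algebra.
From mathcomp Require Import zify.

Set Implicit Arguments.
Unset Strict Implicit.
Unset Printing Implicit Defensive.

Import GRing.Theory.
Local Open Scope ring_scope.

(** * Linear spans and subspaces *)

Section Span.

Variable K : fieldType.
Implicit Types V W : lmodType K.

Inductive lspan V (S : V -> Prop) : V -> Prop :=
| lspan0 : lspan S 0
| lspanZD c u x of S u & lspan S x : lspan S (c *: u + x).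

Definition subspace V (P : V -> Prop) :=
  P 0 /\ forall c x y, P x -> P y -> P (c *: x + y).

Lemma lspan_min V (S P : V -> Prop) :
  subspace P -> (forall u, S u -> P u) -> forall x, lspan S x -> P x.
Proof.
move=> [P0 PZD] SP x; elim=> // c u {}x Su _ Px; exact: PZD (SP _ Su) Px.
Qed.

Lemma subspaceD V (P : V -> Prop) x y : subspace P -> P x -> P y -> P (x + y).
Proof. by move=> [_ PZD] Px Py; rewrite -[x]scale1r; apply: PZD. Qed.

Lemma subspaceZ V (P : V -> Prop) c x : subspace P -> P x -> P (c *: x).
Proof. by move=> [P0 PZD] Px; rewrite -[_ *: _]addr0; apply: PZD. Qed.

Lemma subspaceB V (P : V -> Prop) x y : subspace P -> P x -> P y -> P (x - y).
Proof.
by move=> sP Px Py; apply: subspaceD => //; rewrite -scaleN1r; apply: subspaceZ.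
Qed.

Lemma subspace_sum V (P : V -> Prop) (I : Type) (r : seq I) (F : I -> V) :
  subspace P -> (forall i, P (F i)) -> P (\sum_(i <- r) F i).
Proof.
move=> sP PF; elim: r => [|i r IH]; first by rewrite big_nil; case: sP.
by rewrite big_cons; apply: subspaceD.
Qed.

Lemma subspace_eq0 V : subspace (fun x : V => x = 0).
Proof. by split=> // c x y -> ->; rewrite scaler0 addr0. Qed.

Lemma linear_map0 V W (f : V -> W) : linear f -> f 0 = 0.
Proof.
by move=> lf; have := lf (-1) 0 0; rewrite !scaleN1r oppr0 addr0 addNr.
Qed.

Lemma subspace_preim V W (f : V -> W) (P : W -> Prop) :
  linear f -> subspace P -> subspace (fun x => P (f x)).
Proof.
move=> lf [P0 PZD]; split=> [|c x y Px Py]; first by rewrite linear_map0.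
by rewrite lf; apply: PZD.
Qed.

Lemma subspace_lspan V (S : V -> Prop) : subspace (lspan S).
Proof.
split=> [|c x y Sx Sy]; first exact: lspan0.
elim: Sx => [|d u {}x Su _ IH]; first by rewrite scaler0 add0r.
by rewrite scalerDr scalerA -addrA; apply: lspanZD.
Qed.

Lemma lspan_gen V (S : V -> Prop) u : S u -> lspan S u.
Proof.
by move=> Su; rewrite -[u]scale1r -[_ *: _]addr0; apply: lspanZD (lspan0 _).
Qed.

End Span.

(** * Long commutators and products of two of them *)

Section Commutators.

Variables (K : fieldType) (R : algType K).
Implicit Types x y z : R.

Lemma commutator_linearl z : linear (fun x => commutator x z).
Proof.
move=> c x y; rewrite /commutator mulrDl mulrDr -scalerAl -scalerAr.
by rewrite opprD addrACA scalerBr.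
Qed.

Lemma commutator_linearr z : linear (commutator z).
Proof.
move=> c x y; rewrite /commutator mulrDl mulrDr -scalerAl -scalerAr.
by rewrite opprD addrACA scalerBr.
Qed.

Lemma commutatorMl x y z :
  commutator (x * y) z = x * commutator y z + commutator x z * y.
Proof. by rewrite /commutator mulrBr mulrBl !mulrA addrA subrK. Qed.

Lemma commutatorBl x y z :
  commutator (x - y) z = commutator x z - commutator y z.
Proof.
by rewrite addrC -scaleN1r commutator_linearl scaleN1r addrC.
Qed.

Lemma commutator_jacobi x y z :
  commutator x (commutator y z) =
  commutator (commutator x y) z - commutator (commutator x z) y.
Proof.
apply/esym/eqP; rewrite subr_eq; apply/eqP.
rewrite {2}/commutator commutatorBl !commutatorMl.
by rewrite opprD [- _ - _]addrC addrACA.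
Qed.

(* [lcs n] is the span of the commutators with [n] brackets, that is of length
   [n.+1]. *)
Fixpoint lcs (n : nat) : R -> Prop :=
  if n is n'.+1 then
    lspan (fun x => exists y z, lcs n' y /\ x = commutator y z)
  else fun=> True.

Lemma subspace_lcs n : subspace (lcs n).
Proof. by case: n => [|n]; [split | apply: subspace_lspan]. Qed.

Lemma lcs_step n y z : lcs n y -> lcs n.+1 (commutator y z).
Proof. by move=> ny; apply: lspan_gen; exists y, z. Qed.

Lemma lcs_min n (P : R -> Prop) : subspace P ->
  (forall y z, lcs n y -> P (commutator y z)) -> forall x, lcs n.+1 x -> P x.
Proof.
by move=> sP nP; apply: lspan_min => // _ [y [z [ny ->]]]; apply: nP.
Qed.

(** Induction on [j]: the Jacobi identity replaces the bracket with [commutator u v] by successive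
    brackets with [u] and [v], in both orders. *)
Lemma lcs_commutator i j x y :
  lcs i x -> lcs j y -> lcs (i + j).+1 (commutator x y).
Proof.
elim: j i x y => [|j IH] i x y ix jy; first by rewrite addn0; apply: lcs_step.
move: y jy; apply: lcs_min => [|u v ju].
  exact: subspace_preim (commutator_linearr x) (subspace_lcs _).
rewrite commutator_jacobi; apply: subspaceB; first exact: subspace_lcs.
  by rewrite addnS; apply: lcs_step; apply: IH.
by rewrite addnS -addSn; apply: IH => //; apply: lcs_step.
Qed.

Lemma lcs_long_commutator n : (forall x, lcs n x -> x = 0) ->
  lie_nilpotent_identity R n.+1.
Proof.
move=> nil x; apply: nil; case/tupleP: x => x s /=.
suff: forall m u (t : seq R),
    lcs m u -> lcs (m + size t) (foldl (@commutator R) u t).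
  by move/(_ 0%N x s I); rewrite size_tuple.
move=> m u t; elim: t m u => [|y t IH] m u mu /=; first by rewrite addn0.
by rewrite addnS -addSn; apply/IH/lcs_step.
Qed.

(** [n] counts the brackets of both factors together. With [m = 1] both factors are genuine
    commutators; [m = 0] also admits arbitrary elements as factors. *)
Definition lcs_prod (m n : nat) : R -> Prop :=
  lspan (fun z => exists p q x y, [/\ (m <= p)%N, (m <= q)%N, (p + q)%N = n &
    [/\ lcs p x, lcs q y & z = x * y]]).

Lemma lcs_prodM m n p q x y : (m <= p)%N -> (m <= q)%N -> (p + q)%N = n ->
  lcs p x -> lcs q y -> lcs_prod m n (x * y).
Proof. by move=> mp mq pqn px qy; apply: lspan_gen; exists p, q, x, y. Qed.

Lemma lcs_prod_commutator m n x y :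
  lcs_prod m n x -> lcs_prod m n.+1 (commutator x y).
Proof.
move: x; apply: lspan_min.
  exact: subspace_preim (commutator_linearl y) (subspace_lspan _).
move=> _ [p [q [u [v [mp mq pqn [pu qv ->]]]]]].
rewrite commutatorMl; apply: subspaceD; first exact: subspace_lspan.
  by apply: (lcs_prodM (p := p) (q := q.+1)) => //;
     [apply: leqW | rewrite addnS pqn | apply: lcs_step].
by apply: (lcs_prodM (p := p.+1) (q := q)) => //;
   [apply: leqW | rewrite addSn pqn | apply: lcs_step].
Qed.

(* Expanding [[... [a b, c_1], ..., c_r]] by the Leibniz rule, with
   [x = [a, c_1, ..., c_r]], all terms but [x * b] are products of two
   commutators. *)
Lemma lcs_leibniz r x b : lcs r.+1 x ->
  exists2 w, lcs r w & lcs_prod 1 r.+1 (w - x * b).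
Proof.
elim: r x => [|r IH] x rx.
  by exists (x * b) => //; rewrite subrr; apply: lspan0.
move: x rx; apply: lcs_min.
  split=> [|c x y [w rw wx] [v rv vy]].
    exists 0; first by case: (subspace_lcs r.+1).
    by rewrite mul0r subrr; apply: lspan0.
  exists (c *: w + v); first exact: (subspace_lcs r.+1).2.
  rewrite mulrDl -scalerAl opprD addrACA -scalerBr.
  exact: (subspace_lspan _).2.
move=> y z ry; have [w rw wy] := IH y ry.
exists (commutator w z); first exact: lcs_step.
have ->: commutator w z - commutator y z * b =
         commutator (w - y * b) z + y * commutator b z.
  by rewrite commutatorBl commutatorMl opprD addrA addrAC subrK.
apply: subspaceD; first exact: subspace_lspan.
  exact: lcs_prod_commutator.
by apply: (lcs_prodM (p := r.+1) (q := 1)) => //;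
   [rewrite addn1 | apply: (@lcs_step 0)].
Qed.

Section Nilpotent.

Variable N : nat.
Hypothesis nilN : forall x, lcs N x -> x = 0.

Lemma lcs_nil n x : (N <= n)%N -> lcs n x -> x = 0.
Proof.
move=> /subnK <-; elim: (n - N)%N x => [|d IH] x; first exact: nilN.
rewrite addSn; move: x; apply: lcs_min => [|y z /IH ->].
  exact: subspace_eq0.
by rewrite (linear_map0 (commutator_linearl z)).
Qed.

(* The expansion of [lcs_leibniz] for [x] in [lcs i] is bracketed with [d] in
   [lcs j.-1]: the left-hand side vanishes, and induction on [i] kills all the
   terms but [x * [b, d]]. *)
Lemma lcs_mul_eq0 i j x y : (i + j)%N = N.+1 -> lcs i x -> lcs j y -> x * y = 0.
Proof.
elim/ltn_ind: i j x y => [[|i] IH] j x y.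
  by rewrite add0n => -> _ /(lcs_nil (leqnSn N)) ->; rewrite mulr0.
case: j => [|j] ijN ix jy.
  by rewrite (lcs_nil _ ix) ?mul0r // -ltnS -ijN addn0.
move: y jy; apply: lcs_min => [|d b jd].
  apply: (@subspace_preim _ _ _ ( *%R x)) (@subspace_eq0 _ _).
  by move=> c u v; rewrite mulrDr scalerAr.
have eN : (i + j).+1 = N by move: ijN; rewrite addSn addnS => - [].
have [w iw wx] := lcs_leibniz b ix.
have wd0 : commutator w d = 0.
  by apply: (lcs_nil (n := (i + j).+1)); [rewrite eN | apply: lcs_commutator].
have xd0 : commutator x d = 0.
  apply: (lcs_nil (n := (i.+1 + j).+1)); first by rewrite addSn eN.
  exact: lcs_commutator.
have: commutator (w - x * b) d = 0.
  move: (w - x * b) wx; apply: lspan_min.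
    exact: subspace_preim (commutator_linearl d) (@subspace_eq0 _ _).
  move=> _ [p [q [u [v [p0 q0 pqi [pu qv ->]]]]]].
  have ltpi : (p < i.+1)%N by rewrite -pqi -addn1 leq_add2l.
  have ltqi : (q < i.+1)%N by rewrite -pqi -add1n leq_add2r.
  have ud := lcs_commutator pu jd; have vd := lcs_commutator qv jd.
  have upj : ((p + j).+1 + q)%N = N.+1.
    by rewrite addSn addnAC pqi addSn eN.
  have vqj : (p + (q + j).+1)%N = N.+1.
    by rewrite addnS addnA pqi addSn eN.
  rewrite commutatorMl (IH p ltpi _ _ _ vqj pu vd) add0r.
  (* The first factor of [commutator u d * v] may have too many brackets for the induction; but the
     two factors commute, and [v] has fewer brackets than [x]. *)
  have /eqP : commutator (commutator u d) v = 0.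
    apply: (lcs_nil (n := ((p + j).+1 + q).+1)); first by rewrite upj leqW.
    exact: lcs_commutator.
  rewrite subr_eq0 => /eqP ->; apply: IH ltqi _ _ _ _ qv ud.
  by rewrite addnC.
rewrite commutatorBl wd0 sub0r commutatorMl xd0 mul0r addr0 => /eqP.
rewrite oppr_eq0 => /eqP xbd.
by rewrite -[commutator d b]opprB -/(commutator b d) mulrN xbd oppr0.
Qed.

End Nilpotent.

End Commutators.

(** * Spans in tensor products and nonvanishing of tensors *)

Section Bilinear.

Variable K : fieldType.
Implicit Types A B R : algType K.

Lemma lspan_commutator R (S T U : R -> Prop) x y :
  (forall s t, S s -> T t -> lspan U (commutator s t)) ->
  lspan S x -> lspan T y -> lspan U (commutator x y).
Proof.
move=> STU Sx Ty; move: x Sx; apply: lspan_min => [|s Ss].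
  exact: subspace_preim (commutator_linearl y) (subspace_lspan _).
move: y Ty; apply: lspan_min => [|t Tt]; last exact: STU.
exact: subspace_preim (commutator_linearr s) (subspace_lspan _).
Qed.

Lemma lspan_tensor A B (S : A -> Prop) (T : B -> Prop) :
  (forall a, lspan S a) -> (forall b, lspan T b) ->
  forall x : tensor A B,
    lspan (fun z => exists a b, [/\ S a, T b & z = tens a b]) x.
Proof.
move=> Sa Tb x; rewrite [x]tensorE; apply: subspace_sum => [|[a b] /=].
  exact: subspace_lspan.
move: a (Sa a); apply: lspan_min => [|a Sa'].
  exact: subspace_preim ((@tensor_bilinear K A B).1 b) (subspace_lspan _).
move: b (Tb b); apply: lspan_min => [|b Tb'].
  exact: subspace_preim ((@tensor_bilinear K A B).2 a) (subspace_lspan _).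
by apply: lspan_gen; exists a, b.
Qed.

Lemma tensBl A B (a a' : A) (b : B) : tens (a - a') b = tens a b - tens a' b.
Proof.
rewrite addrC -scaleN1r.
by rewrite ((@tensor_bilinear K A B).1 b) /= scaleN1r addrC.
Qed.

Lemma prod_tens1 A B (I : Type) (s : seq I) (F : I -> A) :
  \prod_(i <- s) (tens (F i) 1 : tensor A B) = tens (\prod_(i <- s) F i) 1.
Proof.
elim: s => [|i s IH]; first by rewrite !big_nil.
by rewrite !big_cons IH tensM mulr1.
Qed.

(** Nonvanishing is witnessed by a functional because functionals on two factors multiply to one on
    their tensor product. *)
Definition detected (V : lmodType K) (x : V) :=
  exists2 f : V -> K^o, linear f & f x != 0.

Lemma detectedZ (V : lmodType K) c (x : V) :
  c != 0 -> detected x -> detected (c *: x).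
Proof.
move=> c0 [f lf fx]; exists f => //.
by rewrite -[_ *: _]addr0 lf (linear_map0 lf) addr0 mulf_neq0.
Qed.

Lemma detected_preim (V W : lmodType K) (g : V -> W) x :
  linear g -> detected (g x) -> detected x.
Proof.
by move=> lg [f lf fx]; exists (f \o g) => // c u v /=; rewrite lg lf.
Qed.

Lemma detected_neq0 (V : lmodType K) (x : V) : detected x -> x <> 0.
Proof. by move=> [f lf fx] x0; rewrite x0 linear_map0 // eqxx in fx. Qed.

Lemma detected_tens A B (a : A) (b : B) :
  detected a -> detected b -> detected (tens a b).
Proof.
move=> [f lf fa] [g lg gb].
pose h (x : A) (y : B) : K^o := f x * g y.
have hh : bilinear_for *:%R *:%R h.
  split=> u c x y; rewrite /h /=; first by rewrite lf mulrDl -scalerAl.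
  by rewrite lg mulrDr -scalerAr.
have [lh ht] := tensor_liftP hh.
by exists (tensor_lift h) => //; rewrite ht mulf_neq0.
Qed.

End Bilinear.

(** * Monomials in anticommuting elements *)

Section Anticommuting.

Variables (K : fieldType) (R : algType K) (I : Type).
Implicit Types (g : I -> R) (w : seq I).

Definition monom g w : R := \prod_(i <- w) g i.

Definition anticommuting g := forall i j, g i * g j = - (g j * g i).

Lemma monom_cat g w w' : monom g (w ++ w') = monom g w * monom g w'.
Proof. exact: big_cat. Qed.

Lemma monom_cons g i w : monom g (i :: w) = g i * monom g w.
Proof. exact: big_cons. Qed.

Lemma monom1 g i : monom g [:: i] = g i.
Proof. exact: big_seq1. Qed.

Variable g : I -> R.
Hypothesis anti : anticommuting g.

Lemma monom_swap1 i w : g i * monom g w = (-1) ^+ size w *: (monom g w * g i).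
Proof.
elim: w => [|j w IH]; first by rewrite /monom big_nil mul1r mulr1 scale1r.
rewrite monom_cons mulrA anti mulNr -(mulrA _ (g i)) IH -scalerAr mulrA.
by rewrite exprS mulN1r scaleNr.
Qed.

Lemma monom_swap w w' :
  monom g w' * monom g w = (-1) ^+ (size w * size w') *: monom g (w ++ w').
Proof.
rewrite monom_cat.
elim: w' => [|i w' IH].
  by rewrite /monom big_nil muln0 scale1r mul1r mulr1.
rewrite monom_cons -mulrA IH -scalerAr (mulrA (g i)).
rewrite monom_swap1 -scalerAl scalerA -exprD -mulrA.
by rewrite [in RHS]mulnS addnC.
Qed.

Lemma commutator_monom w w' :
  commutator (monom g w) (monom g w') =
  (1 - (-1) ^+ (size w * size w')) *: monom g (w ++ w').
Proof.
by rewrite /commutator (monom_swap w w') -monom_cat scalerBl scale1r.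
Qed.

End Anticommuting.

(** Moving a repeated letter next to its twin costs only a sign. Squares are assumed to vanish
    separately, since anticommutation only kills twice the square. *)
Lemma monom_dup (K : fieldType) (R : algType K) (I : eqType) (g : I -> R) w :
  anticommuting g -> (forall i, g i * g i = 0) -> ~~ uniq w -> monom g w = 0.
Proof.
move=> anti sq; elim: w => [//|i w IH] /=.
rewrite negb_and negbK monom_cons.
case/orP => [|/IH ->]; last by rewrite mulr0.
case/splitPr => u v; rewrite monom_cat mulrA monom_swap1 // -scalerAl.
by rewrite monom_cons -mulrA (mulrA (g i) (g i)) sq mul0r mulr0 scaler0.
Qed.

(** The sign from swapping the right-hand words is absorbed on the left: the left factor is the
    commutator of [x] and [y], or their anticommutator when both words have odd size. *)
Lemma commutator_tens_monom (K : fieldType) (R B : algType K) (J : Type)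
    (h : J -> B) (x y : R) (v v' : seq J) : anticommuting h ->
  commutator (tens x (monom h v)) (tens y (monom h v')) =
  tens (x * y - (-1) ^+ (size v * size v') *: (y * x)) (monom h (v ++ v')).
Proof.
move=> anti; rewrite /commutator !tensM (monom_swap anti v) -monom_cat.
by rewrite tensZr -tensZl -tensBl.
Qed.

(** * Spanning monomials of a Grassmann algebra *)

Section Words.

Variables (K : fieldType) (V : lmodType K).

Lemma gr_gen_anticommuting : anticommuting (@gr_gen K V).
Proof.
move=> u v; have := gr_gen_sqr (u + v).
have ->: gr_gen (u + v) = gr_gen u + gr_gen v.
  by have := gr_gen_linear 1 u v; rewrite !scale1r.
rewrite mulrDl !mulrDr !gr_gen_sqr add0r addr0 => /eqP.
by rewrite addr_eq0 => /eqP.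
Qed.

Lemma lspan_words (I : Type) (g : I -> V) :
  (forall v, lspan (fun u => exists i, u = g i) v) ->
  forall x : grassmann V,
    lspan (fun u => exists w, u = monom (fun i => gr_gen (g i)) w) x.
Proof.
move=> gV x; rewrite [x]grassmannE; apply: subspace_sum => [|[c s] /=].
  exact: subspace_lspan.
apply: subspaceZ; first exact: subspace_lspan.
elim: s => [|v s IH].
  by rewrite big_nil; apply: lspan_gen; exists [::]; rewrite /monom big_nil.
rewrite big_cons; move: (\prod_(u <- s) _) IH; apply: lspan_min => [|_ [w ->]].
  apply: (@subspace_preim _ _ _ ( *%R (gr_gen v))) (subspace_lspan _).
  by move=> a y z; rewrite mulrDr -scalerAr.
move: v (gV v); apply: lspan_min => [|_ [i ->]].
  apply: (@subspace_preim _ _ _ (fun v => gr_gen v * _)) (subspace_lspan _).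
  by move=> a y z; rewrite gr_gen_linear mulrDl -scalerAl.
by apply: lspan_gen; exists (i :: w); rewrite monom_cons.
Qed.

End Words.

(** * Upper bound: vanishing of long commutators *)

Section Upper.

Variable K : fieldType.

Definition letter r (i : 'I_r) : E_fin K r := gr_gen (delta_mx 0 i).

Lemma letter_anticommuting r : anticommuting (@letter r).
Proof. by move=> i j; apply: gr_gen_anticommuting. Qed.

Lemma lspan_letters r (x : E_fin K r) :
  lspan (fun u => exists w, u = monom (@letter r) w) x.
Proof.
apply: lspan_words => {x} v; rewrite [v]row_sum_delta.
apply: subspace_sum => [|i]; first exact: subspace_lspan.
by apply: subspaceZ (subspace_lspan _) _; apply: lspan_gen; exists i.
Qed.

Lemma letters_eq0 r (w : seq 'I_r) : (r < size w)%N -> monom (@letter r) w = 0.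
Proof.
move=> rw; apply: monom_dup; [exact: letter_anticommuting | |].
  by move=> i; apply: gr_gen_sqr.
apply/negP => /card_uniqP cw; have := max_card (mem w).
by rewrite cw card_ord leqNgt rw.
Qed.

Lemma lspan_E_inf (x : E_inf K) :
  lspan (fun u => exists w, u = monom (@gr_gen K {poly K}) w) x.
Proof. by apply: (@lspan_words _ _ _ id) => v; apply: lspan_gen; exists v. Qed.

(* Only steps between anticommuting monomials survive, so after at least one
   bracket the two degrees are never both odd, and all the entries except the
   first two and the last one have odd degree in the second factor. *)
Lemma lcs_E_E_fin r n (x : tensor (E_inf K) (E_fin K r)) : lcs n x ->
  lspan (fun z => exists w v,
    [/\ (0 < n)%N -> ~~ (odd (size w) && odd (size v)),
    (n <= size v + ~~ (odd (size w) || odd (size v)))%N &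
    z = tens (monom (@gr_gen K {poly K}) w) (monom (@letter r) v)]) x.
Proof.
have spn y := lspan_tensor lspan_E_inf (@lspan_letters r) y.
elim: n x => [|n IH] x.
  move=> _; move: x (spn x); apply: lspan_min; first exact: subspace_lspan.
  by move=> _ [_ [_ [[w ->] [v ->] ->]]]; apply: lspan_gen; exists w, v.
move: x; apply: lcs_min => [|y z /IH ny]; first exact: subspace_lspan.
apply: lspan_commutator ny (spn z) 
  => _ _ [w [v [nodd nv ->]]] [_ [_ [[w' ->] [v' ->] ->]]].
rewrite commutator_tens_monom; last exact: letter_anticommuting.
rewrite (monom_swap (@gr_gen_anticommuting _ _) w) -monom_cat scalerA -exprD.
rewrite -[X in tens (X - _)]scale1r -scalerBl tensZl.
case: (boolP (odd (size v * size v' + size w * size w'))) => [sgn|/negbTE sgn].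
  apply: subspaceZ (subspace_lspan _) _; apply: lspan_gen.
  exists (w ++ w'), (v ++ v'); split=> //; rewrite !size_cat !oddD.
    move: sgn; rewrite oddD !oddM.
    by do 4!case: (odd _).
  (* An odd [v'] adds a letter. An even one survives only if [w] and [w'] are odd; for [n > 0] both
     new degrees are then even, and the parity term of the bound supplies the missing unit. *)
  have odd_leq m : (odd m <= m)%N.
    by case: m => // m; apply: leq_trans (leq_b1 _) _.
  move: (odd_leq (size v)) (odd_leq (size v')) nodd nv sgn; rewrite oddD !oddM.
  do 4!case: (odd _) => //=; lia.
by rewrite -signr_odd sgn subrr scale0r; apply: lspan0.
Qed.
(** The parity term of the degree bound is at most one, so [r.+2] brackets force a word of more than
    [r] letters. *)
Lemma lcs_E_E_fin_eq0 r (x : tensor (E_inf K) (E_fin K r)) :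
  lcs r.+2 x -> x = 0.
Proof.
move=> /lcs_E_E_fin; move: x; apply: lspan_min; first exact: subspace_eq0.
move=> _ [w [v [_ rv ->]]]; rewrite letters_eq0; last first.
  by rewrite -ltnS (leq_trans rv) // -addn1 leq_add2l leq_b1.
exact: linear_map0 ((@tensor_bilinear K _ _).2 _).
Qed.

(* The second alternative appears at the second odd entry [c], which turns the
   left factor [b] into [b c + c b]; the right factor is then central. *)
Lemma lcs_tensor_E2 (R : algType K) n (x : tensor R (E_fin K 2)) : lcs n x ->
  lspan (fun z => exists b v,
    [/\ lcs n b \/ (1 < size v)%N /\ exists2 p, n = p.+1 & lcs_prod 0 p b &
      z = tens b (monom (@letter 2) v)]) x.
Proof.
have spn y := @lspan_tensor _ R (E_fin K 2) (fun=> True) _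
  (fun a => lspan_gen I) (@lspan_letters 2) y.
elim: n x => [|n IH] x.
  move=> _; move: x (spn x); apply: lspan_min; first exact: subspace_lspan.
  move=> _ [b [_ [_ [v ->] ->]]].
  by apply: lspan_gen; exists b, v; split=> //; left.
move: x; apply: lcs_min => [|y z /IH ny]; first exact: subspace_lspan.
apply: lspan_commutator ny (spn z)
  => _ _ [b [v [nb ->]]] [c [_ [_ [v' ->] ->]]].
rewrite commutator_tens_monom; last exact: letter_anticommuting.
rewrite -signr_odd; have [sgn|_] := boolP (odd (size v * size v')); last first.
  rewrite scale1r -/(commutator b c); apply: lspan_gen.
  exists (commutator b c), (v ++ v'); split=> //.
  case: nb => [nb|[v2 [p -> pb]]]; [left; exact: lcs_step | right].
  split; first by rewrite size_cat ltn_addr.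
  by exists p.+1 => //; apply: lcs_prod_commutator.
have [v0 v'0] : (0 < size v /\ 0 < size v')%N.
  by move: sgn; rewrite oddM => /andP[/odd_gt0 ? /odd_gt0].
(* If the right word already has two letters, the odd [v'] adds a third and the word vanishes in
   [E_fin K 2]. *)
case: nb => [nb|[v2 _]]; last first.
  rewrite letters_eq0; last by rewrite size_cat -addn1 leq_add.
  by rewrite (linear_map0 ((@tensor_bilinear K _ _).2 _)); apply: lspan0.
rewrite expr1 scaleN1r opprK; apply: lspan_gen.
exists (b * c + c * b), (v ++ v'); split=> //; right; split.
  by rewrite size_cat (leq_add v0 v'0).
exists n => //; apply: subspaceD; first exact: subspace_lspan.
  by apply: (lcs_prodM (p := n) (q := 0)); rewrite ?addn0.
exact: (lcs_prodM (p := 0) (q := n)).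
Qed.

(** In the second alternative one bracket has become an anticommutator, so [N.+1] of the [N.+2]
    brackets remain, which is the total required by [lcs_mul_eq0]. *)
Lemma lcs_tensor_E2_eq0 (R : algType K) N : (forall x : R, lcs N x -> x = 0) ->
  forall x : tensor R (E_fin K 2), lcs N.+2 x -> x = 0.
Proof.
move=> nilN x /lcs_tensor_E2; move: x; apply: lspan_min.
  exact: subspace_eq0.
move=> _ [b [v [nb ->]]].
suff ->: b = 0 by rewrite (linear_map0 ((@tensor_bilinear K _ _).1 _)).
case: nb => [/(lcs_nil nilN)-> //|[_ [_ [<-]]]]; first exact: leqW.
move: b; apply: lspan_min; first exact: subspace_eq0.
by move=> _ [p [q [x [y [_ _ pqN [px qy ->]]]]]]; apply: lcs_mul_eq0 pqN px qy.
Qed.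

Lemma lcs_tensor_iter_eq0 k l
    (x : tensor_iter (tensor (E_inf K) (E_fin K (2 * k))) (E_fin K 2) l) :
  lcs (2 * k + 2 * l).+2 x -> x = 0.
Proof.
elim: l x => [|l IH] /= x; first by rewrite addn0; apply: lcs_E_E_fin_eq0.
rewrite mulnS addnCA !addSn; exact: lcs_tensor_E2_eq0 IH x.
Qed.

End Upper.

(** * Lower bound: nonzero commutators *)

Section Lower.

Variable K : fieldType.

(* Each step adjoins a generator [p (x) N], where [p] anticommutes with the
   previous generators and [N] is a nilpotent 2 x 2 matrix. *)
Lemma anticommuting_model r : exists (B : algType K) (g : nat -> B) (p : B),
  [/\ anticommuting g, forall i, g i * g i = 0, p * p = 1,
      forall i, p * g i = - (g i * p) & detected (monom g (iota 0 r))].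
Proof.
elim: r => [|r [B [g [p [anti sq pp pg [f lf fg]]]]]].
  exists K^o, (fun=> 0), 1.
  split=> [i j|i||i|]; rewrite ?mulr0 ?mul0r ?oppr0 ?mulr1 //.
  by exists id => //; rewrite /monom big_nil oner_neq0.
pose M : algType K := 'M[K]_2.
pose N : M := delta_mx 0 1.
(* [D] is diag(1, -1), which anticommutes with [N]; hence [tens p D] anticommutes with the old
   generators through [p] and with [tens p N] through [D]. *)
pose D : M := diag_mx (\row_j (-1) ^+ j).
have NN : N * N = 0 by rewrite /N -[_ * _]/(_ *m _) mul_delta_mx_0.
have DN : D * N = N.
  apply/matrixP => i j; rewrite -[_ * _]/(_ *m _) mul_diag_mx !mxE.
  by case: eqP => [->|]; rewrite ?mul1r ?mulr0.
have ND : N * D = - N.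
  apply/matrixP => i j; rewrite -[_ * _]/(_ *m _) mul_mx_diag !mxE.
  by case: eqP => _; case: eqP => [->|]; rewrite ?mul1r ?mul0r ?oppr0.
have DD : D * D = 1.
  rewrite -[_ * _]/(_ *m _) mulmx_diag; apply/matrixP => i j; rewrite !mxE.
  by rewrite -expr2 sqrr_sign.
have t0 b : tens (0 : B) b = (0 : tensor B M).
  exact: linear_map0 ((@tensor_bilinear K B M).1 b).
have tNl (a : B) (b : M) : tens (- a) b = - tens a b.
  by rewrite -scaleN1r tensZl scaleN1r.
have tNr (a : B) (b : M) : tens a (- b) = - tens a b.
  by rewrite -scaleN1r tensZr scaleN1r.
have t0r (a : B) : tens a 0 = (0 : tensor B M).
  exact: linear_map0 ((@tensor_bilinear K B M).2 a).
(* Indices beyond [r] get the value 0, which keeps all the relations. *)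
pose g' i : tensor B M :=
  if (i < r)%N then tens (g i) 1 else if i == r then tens p N else 0.
exists (tensor B M), g', (tens p D).
have sq' i : g' i * g' i = 0.
  rewrite /g'; case: ifP => _; first by rewrite tensM sq t0.
  by case: ifP => _; rewrite ?mulr0 // tensM NN t0r.
have pg' i : tens p D * g' i = - (g' i * tens p D).
  rewrite /g'; case: ifP => _.
    by rewrite !tensM pg mulr1 mul1r tNl.
  by case: ifP => _; rewrite ?mulr0 ?mul0r ?oppr0 // !tensM DN ND tNr opprK.
have anti' : anticommuting g'.
  move=> i j; have [->|ij] := eqVneq i j; first by rewrite sq' oppr0.
  rewrite /g'; case: (ltnP i r) => _; case: (ltnP j r) => _.
  - by rewrite !tensM anti tNl.
  - case: ifP => _; rewrite ?mulr0 ?mul0r ?oppr0 //.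
    by rewrite !tensM mul1r mulr1 pg tNl opprK.
  - case: ifP => _; rewrite ?mulr0 ?mul0r ?oppr0 //.
    by rewrite !tensM mul1r mulr1 pg tNl.
  case: eqP => [ir|_]; last by rewrite mul0r mulr0 oppr0.
  case: eqP => [jr'|_]; last by rewrite mul0r mulr0 oppr0.
  by rewrite ir jr' eqxx in ij.
split=> //; first by rewrite tensM pp DD.
have ->: monom g' (iota 0 r.+1) = tens (monom g (iota 0 r) * p) N.
  rewrite -addn1 iotaD monom_cat monom1 /g' add0n ltnn eqxx.
  suff ->: monom g' (iota 0 r) = tens (monom g (iota 0 r)) 1.
    by rewrite tensM mul1r.
  rewrite /monom -prod_tens1; apply: eq_big_seq => i.
  by rewrite mem_iota /g' => /= ->.
apply: detected_tens.
  (* Since [p * p = 1], a second multiplication by [p] recovers the monomial detected by [f]. *)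
  apply: (detected_preim (g := fun x => x * p)); last first.
    by exists f => //; rewrite -mulrA pp mulr1.
  by move=> c x y; rewrite mulrDl -scalerAl.
exists (fun m : M => m 0 1 : K^o); last by rewrite mxE !eqxx oner_neq0.
by move=> c x y; rewrite !mxE.
Qed.

(** The [kappa i] are coordinates dual to the [v j]. Sending [x] to the sum of the
    [kappa i x *: g i] has square zero, so it lifts to the Grassmann algebra and carries the
    monomial to the one detected in the model. *)
Lemma detected_monom_gen (V : lmodType K) (v : nat -> V)
    (kappa : nat -> V -> K^o) r : (forall i, linear (kappa i)) ->
  (forall i j, (i < r)%N -> (j < r)%N -> kappa i (v j) = (i == j)%:R) ->
  detected (monom (fun i => gr_gen (v i)) (iota 0 r)).
Proof.
move=> lk kv; have [B [g [p [anti sq _ _ dg]]]] := anticommuting_model r.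
pose f (n : nat) (x : V) : B := \sum_(i < n) kappa i x *: g i.
have lf n : linear (f n).
  move=> c x y; rewrite /f scaler_sumr -big_split; apply: eq_bigr => i _ /=.
  by rewrite lk scalerDl scalerA.
have f0 n : sqr0 (f n).
  move=> x; elim: n => [|n IH]; first by rewrite /f big_ord0 mulr0.
  rewrite /f big_ord_recr -/(f n x) /= mulrDl !mulrDr IH add0r.
  rewrite -!scalerAl -!scalerAr sq !scaler0 addr0 -scalerDr.
  suff ->: g n * f n x = - (f n x * g n) by rewrite subrr scaler0.
  rewrite /f mulr_sumr mulr_suml -sumrN; apply: eq_bigr => i _.
  by rewrite -scalerAr anti scalerN scalerAl.
pose F : {linear V -> B} :=
  HB.pack (f r) (GRing.isLinear.Build K V B _ (f r) (lf r)).
have [lF [F1 FM] Fgen] := grassmann_liftP (f0 r : sqr0 F).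
apply: (detected_preim lF).
suff ->: grassmann_lift F (monom (fun i => gr_gen (v i)) (iota 0 r)) =
         monom g (iota 0 r) by [].
have FP s : grassmann_lift F (monom (fun i => gr_gen (v i)) s) =
         monom (fun i => F (v i)) s.
  elim: s => [|i s IH]; first by rewrite /monom !big_nil.
  by rewrite !monom_cons FM IH Fgen.
rewrite FP; apply: eq_big_seq => i; rewrite mem_iota add0n => /= ir.
rewrite /f (bigD1 (Ordinal ir)) //= kv // eqxx scale1r big1 ?addr0 // => j ji.
by rewrite kv // (_ : (j == i :> nat) = false) ?scale0r //; apply/negbTE.
Qed.

Definition E_inf_gen (i : nat) : E_inf K := gr_gen 'X^i.

Lemma detected_E_inf r : detected (monom E_inf_gen (iota 0 r)).
Proof.
apply: (@detected_monom_gen {poly K} (fun i => 'X^i) (fun i p => p`_i))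
  => [i c p q|i j _ _].
  by rewrite coefD coefZ.
by rewrite coefXn.
Qed.

(** For [i < r] this is the generator of the [i]-th standard basis row, indexed by [nat] so that its
    coordinates are polynomial coefficients. *)
Definition E_fin_gen r (i : nat) : E_fin K r := gr_gen (poly_rV 'X^i).

Lemma detected_E_fin r : detected (monom (@E_fin_gen r) (iota 0 r)).
Proof.
apply: (@detected_monom_gen 'rV[K]_r (fun i => poly_rV 'X^i)
  (fun i p => (rVpoly p)`_i)) => [i c p q|i j _ jr].
  by rewrite linearP coefD coefZ.
by rewrite poly_rV_K ?size_polyXn // coefXn.
Qed.

(** All odd [m] are needed: a tensor step lengthens the initial monomial by an even number of
    generators before the commutators of [R] take over. *)
Definition nonzero_commutators (R : algType K) (e : nat -> R) (n : nat) :=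
  forall m, odd m -> exists2 s, size s = n &
    detected (foldl (@commutator R) (monom e (iota 0 m)) s).

Hypothesis char2 : 2%N \notin [pchar K].

Lemma two_neq0 : 2%:R != 0 :> K.
Proof. by move: char2; rewrite inE. Qed.

Lemma foldl_commutatorZ (R : algType K) c (x : R) s :
  foldl (@commutator R) (c *: x) s = c *: foldl (@commutator R) x s.
Proof.
elim: s x => //= y s IH x; rewrite -IH; congr foldl.
by rewrite /commutator -scalerAl -scalerAr scalerBr.
Qed.

Lemma nonzero_commutators_E_inf : nonzero_commutators E_inf_gen 1.
Proof.
move=> m odd_m; exists [:: E_inf_gen m] => //=.
have anti : anticommuting E_inf_gen by move=> i j; apply: gr_gen_anticommuting.
rewrite -(monom1 E_inf_gen) commutator_monom // size_iota muln1.
rewrite -signr_odd odd_m.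
rewrite expr1 opprK -[_ ++ _]/(iota 0 m ++ iota (0 + m) 1) -iotaD.
exact: detectedZ two_neq0 (detected_E_inf _).
Qed.

(** Bracketing with [tens (e (m + j)) (f j)] for [j < d] builds up the full monomial in [f]; the
    entries [tens x 1] then act on the left factor only. *)
Lemma nonzero_commutators_tensor (R B : algType K) (e : nat -> R) (f : nat -> B)
    d n : ~~ odd d -> anticommuting e -> anticommuting f ->
  detected (monom f (iota 0 d)) -> nonzero_commutators e n ->
  nonzero_commutators (fun i => tens (e i) 1 : tensor R B) (d + n).
Proof.
move=> even_d antie antif fd en m odd_m.
have [s sn es] := en (m + d)%N ltac:(by rewrite oddD odd_m (negbTE even_d)).
pose t c : seq (tensor R B) := [seq tens (e (m + j)%N) (f j) | j <- iota 0 c].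
exists (t d ++ [seq tens x 1 | x <- s]).
  by rewrite size_cat !size_map size_iota sn.
have -> : monom (fun i => tens (e i) 1 : tensor R B) (iota 0 m) =
  tens (monom e (iota 0 m)) 1 by apply: prod_tens1.
have ft c :
    foldl (@commutator (tensor R B)) (tens (monom e (iota 0 m)) 1) (t c) =
    2%:R ^+ c *: tens (monom e (iota 0 (m + c))) (monom f (iota 0 c)).
  elim: c => [|c IH]; first by rewrite /= addn0 /monom big_nil scale1r.
  rewrite -addn1 /t iotaD map_cat foldl_cat -/(t c) IH.
  rewrite foldl_commutatorZ /= add0n.
  rewrite -(monom1 f c) commutator_tens_monom // size_iota muln1 -(monom1 e).
  rewrite (monom_swap antie (iota 0 (m + c))) -monom_cat scalerA -exprD.
  (* The sign exponent is [c + (m + c)], odd like [m], so the two products add up instead of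
     cancelling. *)
  rewrite size_iota muln1 addnCA addnn -signr_odd oddD odd_double odd_m.
  rewrite expr1 scaleN1r opprK -mulr2n -scaler_nat tensZl scalerA -exprSr.
  rewrite -[_ ++ [:: (m + c)%N]]/(iota 0 (m + c) ++ iota (0 + (m + c)) 1).
  rewrite -iotaD.
  by rewrite -[_ ++ [:: c]]/(iota 0 c ++ iota (0 + c) 1) -iotaD -addnA addn1.
have fs x y :
    foldl (@commutator (tensor R B)) (tens x y) [seq tens z 1 | z <- s] =
    tens (foldl (@commutator R) x s) y.
  elim: s x {sn es} => //= z s IH x; rewrite -IH; congr foldl.
  by rewrite /commutator !tensM mulr1 mul1r tensBl.
rewrite foldl_cat ft foldl_commutatorZ fs.
by apply: detectedZ; rewrite ?expf_neq0 ?two_neq0 //; apply: detected_tens.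
Qed.

Lemma tens1_anticommuting (R B : algType K) (e : nat -> R) :
  anticommuting e -> anticommuting (fun i => tens (e i) 1 : tensor R B).
Proof.
by move=> anti i j; rewrite !tensM anti -scaleN1r tensZl scaleN1r.
Qed.

Lemma nonzero_commutators_tensor_iter k l :
  exists2 e : nat ->
      tensor_iter (tensor (E_inf K) (E_fin K (2 * k))) (E_fin K 2) l,
    anticommuting e & nonzero_commutators e (2 * l + (2 * k + 1)).
Proof.
have antif r : anticommuting (@E_fin_gen r).
  by move=> i j; apply: gr_gen_anticommuting.
elim: l => [|l [e antie en]] /=.
  exists (fun i => tens (E_inf_gen i) 1).
    by apply: tens1_anticommuting => i j; apply: gr_gen_anticommuting.
  apply: nonzero_commutators_tensor nonzero_commutators_E_inf => //.
  - by rewrite mul2n odd_double.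
  - by move=> i j; apply: gr_gen_anticommuting.
  exact: detected_E_fin.
exists (fun i => tens (e i) 1); first exact: tens1_anticommuting.
rewrite mulnS -addnA; apply: nonzero_commutators_tensor en => //.
exact: detected_E_fin.
Qed.

End Lower.

Theorem corollary2p12 (K : fieldType) (k l : nat) (hk : (1 <= k)%N)
    (hl : (1 <= l)%N) :
  let A := tensor_iter (tensor (E_inf K) (E_fin K (2 * k))) (E_fin K 2) l in
  (2%N \notin [pchar K] -> 3%N \notin [pchar K] ->
     lie_nilpotent_identity A (2 * k + 2 * l + 3)) /\
  (2%N \notin [pchar K] ->
     ~ lie_nilpotent_identity A (2 * k + 2 * l + 2)).
Proof.
move=> A; split=> [_ _|char2 nil].
  by rewrite addnS addn2; apply/lcs_long_commutator/lcs_tensor_iter_eq0.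
have [e _ en] := nonzero_commutators_tensor_iter char2 k l.
(* With [m = 1] the first entry is a single generator, followed by [2 * l + (2 * k + 1)]
   brackets. *)
have [s sn es] := en 1%N isT.
have ss : size (monom e (iota 0 1) :: s) == (2 * k + 2 * l + 2)%N.
  by rewrite /= sn; apply/eqP; lia.
exact: detected_neq0 es (nil (Tuple ss)).
Qed.
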